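(* Let $P$ be a fixed $(m,t)$-subspace of $R^{n+k}$ and let ${\cal M}_R(m_1,t_1;m,t;n+k,n)$ be the set of all $(m_1,t_1)$-subspaces contained in $P$. Then this set is non-empty if and only if $$0\leq t_1\leq t\leq k\quad\text{and}\quad 0\leq m_1-t_1\leq m-t\leq n.$$ Moreover, if it is non-empty, its size $N_R(m_1,t_1;m,t;n+k,n)$ does not depend on the choice of $P$ and $$N_R(m_1,t_1;m,t;n+k,n)=|R|^{(m_1-t_1)(t-t_1)}N_R(m_1-t_1,m-t)N_R(t_1,t),$$ where $N_R(a,b)=\prod_{j=1}^{\ell}\prod_{i=0}^{a-1}\frac{|R_j|^{b-i}-|M_j|^{b-i}}{|R_j|^{a-i}-|M_j|^{a-i}}$ is the number of $a$-subspaces of $R^b$.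
   Context: $R$ is a finite commutative ring with identity $1\neq 0$, written as a direct product $R=R_1\times\cdots\times R_\ell$ of finite local rings $R_j$ with maximal ideals $M_j$. $R^{N}$ denotes row vectors of length $N$ over $R$. A set $\{\alpha_1,\dots,\alpha_m\}\subseteq R^N$ is unimodular if the matrix with rows $\alpha_i$ has a right inverse. An $m$-subspace of $R^N$ is an $R$-submodule having a basis of $m$ vectors forming a unimodular set; the $0$-subspace is $\{0\}$. Let $e_i$ be the $i$-th standard unit row vector of $R^{n+k}$ and $E=\langle e_{n+1},\dots,e_{n+k}\rangle$. An $m$-subspace $P$ of $R^{n+k}$ is an $(m,t)$-subspace if $P\cap E$ is a $t$-subspace. *)

(* Defs.v *)
From HB Require Import structures.
From mathcomp Require Export all_boot all_order all_algebra.

Set Implicit Arguments.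
Unset Strict Implicit.
Unset Printing Implicit Defensive.

Import Order.TTheory GRing.Theory Num.Theory.
Local Open Scope ring_scope.

(* [idealr_closed] from ring_quotient already requires 1 \notin I, so these
   are the maximal elements among the proper ideals. *)
Definition maximal_ideal (A : finComNzRingType) (I : {set A}) : Prop :=
  idealr_closed I /\
  forall J : {set A}, idealr_closed J -> I \subset J -> J = I.

Definition local_ring_with (A : finComNzRingType) (M : {set A}) : Prop :=
  maximal_ideal M /\ forall M' : {set A}, maximal_ideal M' -> M' = M.

(* R = R_1 x ... x R_l, presented by its projections: x |-> (proj j x)_j is a
   ring morphism into the direct product by the type of [proj]; this says that
   it is a bijection. *)
Definition is_direct_product (R : finComNzRingType) (l : nat)
    (Rj : 'I_l -> finComNzRingType)
    (proj : forall j, {rmorphism R -> Rj j}) : Prop :=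
  forall y : (forall j, Rj j), exists! x : R, forall j, proj j x = y j.

Section Subspaces.
Variable R : finComNzRingType.

(* The vectors alpha_1, ..., alpha_m of R^N are given as the rows of A. *)
Definition unimodular (m N : nat) (A : 'M[R]_(m, N)) : bool :=
  [exists B : 'M[R]_(N, m), A *m B == 1%:M].

Definition rowspan (m N : nat) (A : 'M[R]_(m, N)) : {set 'rV[R]_N} :=
  [set x *m A | x : 'rV[R]_m].

Definition rows_basis (m N : nat) (A : 'M[R]_(m, N)) (V : {set 'rV[R]_N})
    : bool :=
  [forall x : 'rV[R]_m, (x *m A == 0) ==> (x == 0)] && (V == rowspan A).

(* For m = 0 the only matrix is the empty one and the only V is {0}. *)
Definition subspace (m N : nat) (V : {set 'rV[R]_N}) : bool :=
  [exists A : 'M[R]_(m, N), unimodular A && rows_basis A V].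

Definition subspaces (m N : nat) : {set {set 'rV[R]_N}} :=
  [set V | subspace m V].

Definition Espace (n k : nat) : {set 'rV[R]_(n + k)} :=
  rowspan (\matrix_(i < k) (delta_mx 0 (rshift n i) : 'rV[R]_(n + k))).

Definition mt_subspace (n k m t : nat) (P : {set 'rV[R]_(n + k)}) : bool :=
  subspace m P && subspace t (P :&: Espace n k).

Definition mt_subspaces_in (n k m1 t1 : nat) (P : {set 'rV[R]_(n + k)})
    : {set {set 'rV[R]_(n + k)}} :=
  [set Q : {set 'rV[R]_(n + k)} | mt_subspace m1 t1 Q & Q \subset P].

End Subspaces.

(* The exponents a - i are positive for i < a.  The exponents b - i are exact
   when a <= b; when b < a the factors at i = b vanish, so the truncation of
   b - i for i > b is irrelevant. *)
Definition NR (l : nat) (Rj : 'I_l -> finComNzRingType)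
    (Mj : forall j, {set Rj j}) (a b : nat) : rat :=
  \prod_(j < l) \prod_(i < a)
    ((#|Rj j|%:R ^+ (b - i) - #|Mj j|%:R ^+ (b - i)) /
     (#|Rj j|%:R ^+ (a - i) - #|Mj j|%:R ^+ (a - i))).

(* Main.v *)
Require Import Defs.
From mathcomp Require Import all_boot all_order all_algebra.
From mathcomp Require Import ring zify.

Set Implicit Arguments.
Unset Strict Implicit.
Unset Printing Implicit Defensive.

Import GRing.Theory Num.Theory.
Local Open Scope ring_scope.

(** An (m,t)-subspace is the row span of a block matrix [[B, C], [0, D]] with B
    and D unimodular: a unimodular basis of P cap E extends to a basis of P
    because a finite commutative ring has stable range one, and the block B,
    whose rows are independent, is unimodular because an ideal of a finite ring
    without a nonzero annihilator is the unit ideal. If A0 is such a matrix for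
    P, then X |-> rowspan (X A0) maps the block matrices X of the same shape
    onto the (m1,t1)-subspaces of P, and all its fibres are orbits of the
    invertible block triangular matrices. This reduces every count to the
    number U(a,b) of unimodular a x b matrices. Moving a unimodular first row
    to e_1 gives U(a+1,b+1) = U(1,b+1) |R|^a U(a,b), and a row is unimodular
    iff in each local factor some entry lies outside the maximal ideal. *)

(** * Idempotents, units and annihilators in a finite commutative ring *)

Section FiniteRing.
Variable R : finComNzRingType.

(** By pigeonhole the powers of [a] are eventually periodic; an exponent that is a multiple of the
    period and lies past the preperiod gives an idempotent. *)
Lemma idempotent_power (a : R) : exists N, a ^+ N.+1 * a ^+ N.+1 = a ^+ N.+1.
Proof.
have [i [p eq_ip]] : exists i p, a ^+ (i + p.+1) = a ^+ i.
  have /injectivePn[i [j ne_ij eq_ij]] :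
      ~~ injectiveb (fun i : 'I_#|R|.+1 => a ^+ i).
    apply/negP => /injectiveP inj.
    by have := leq_card _ inj; rewrite card_ord ltnn.
  wlog lt_ij : i j ne_ij eq_ij / (i < j)%N.
    move=> th; case: (ltngtP i j) => [/th|/th|/val_inj eq]; last 1 first.
    - by rewrite eq eqxx in ne_ij.
    - exact.
    - by apply; rewrite // eq_sym.
  by exists i, (j - i).-1; rewrite prednK ?subn_gt0 // subnKC // ltnW.
have shift q : a ^+ (i + q * p.+1) = a ^+ i.
  elim: q => [|q IHq]; first by rewrite mul0n addn0.
  by rewrite mulSn addnA exprD eq_ip -exprD.
exists (i.+1 * p.+1).-1; rewrite prednK ?muln_gt0 //.
have le_iN : (i <= i.+1 * p.+1)%N by rewrite (leq_trans (leqnSn i)) ?leq_pmulr.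
rewrite -{1 3}(subnKC le_iN) [in LHS]exprD mulrAC -exprD shift -exprD subnKC //.
Qed.

Lemma regular_unit (c : R) : (forall w, c * w = 0 -> w = 0) -> exists u, c * u = 1.
Proof.
move=> reg; have inj : injective ( *%R c).
  move=> x y /eqP; rewrite -subr_eq0 -mulrBr => /eqP/reg/eqP.
  by rewrite subr_eq0 => /eqP.
by have [d _ cK] := injF_bij inj; exists (d 1); rewrite cK.
Qed.

(* With [e] the idempotent power of [a], the witness is [1 - e]: [a] is
   invertible on the [e]-component and nilpotent on the other, where [b] is
   then invertible. *)
Lemma stable_range_one (a b x y : R) :
  a * x + b * y = 1 -> exists z u, (a + b * z) * u = 1.
Proof.
move=> bez; have [N eN] := idempotent_power a.
exists (1 - a ^+ N.+1); apply: regular_unit => w w0.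
set e := a ^+ N.+1 in eN w0.
have ew : e * w = 0.
  have : a ^+ N * (e * ((a + b * (1 - e)) * w)) = 0 by rewrite w0 !mulr0.
  have -> : a ^+ N * (e * ((a + b * (1 - e)) * w))
          = a ^+ N * a * e * w + a ^+ N * w * b * (e - e * e) by ring.
  by rewrite eN subrr mulr0 addr0 -exprSr eN.
(* As [e * w = 0], [w0] says [b * w = - a * w], so the Bezout relation makes [a * (x - y)] fix [w];
   its power of exponent [N.+1] has the factor [e], which kills [w]. *)
have aw : a * (x - y) * w = w.
  have: (a * x + b * y) * w = w by rewrite bez mul1r.
  move=> {2}<-; apply/eqP; rewrite -subr_eq0; apply/eqP.
  have -> : a * (x - y) * w - (a * x + b * y) * w
          = - y * ((a + b * (1 - e)) * w) - y * b * (e * w) by ring.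
  by rewrite w0 ew !mulr0 subr0.
have awX q : (a * (x - y)) ^+ q * w = w.
  by elim: q => [|q IHq]; rewrite ?expr0 ?mul1r // exprSr -mulrA aw.
by rewrite -(awX N.+1) exprMn mulrAC -/e ew mul0r.
Qed.

(** The scalar [s] drives the induction: [s * e] is a multiple of the first entry [a], so the other
    entries only have to produce [s * (1 - e)], on which [a] acts nilpotently. *)
Lemma ideal_or_annihilator N (v : 'rV[R]_N) (s : R) :
  (exists y : 'cV_N, v *m y = s%:M) \/ (exists2 r, r * s != 0 & (r * s) *: v = 0).
Proof.
elim: N => [|N IHN] in v s *.
  have [->|s0] := eqVneq s 0; last by right; exists 1; rewrite ?mul1r // [LHS]thinmx0.
  by left; exists 0; rewrite mulmx0 raddf0.
rewrite -[N.+1]/(1 + N)%N in v *; rewrite -(hsubmxK v).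
set a := lsubmx v 0 0; set w := rsubmx v.
have -> : lsubmx v = a%:M by rewrite -mx11_scalar.
have [k ek] := idempotent_power a; set e := a ^+ k.+1 in ek.
case: (IHN w (s * (1 - e))) => [[y yP]|[r r0 rw]].
  left; exists (col_mx (s * a ^+ k)%:M y); rewrite mul_row_col yP -scalar_mxM.
  by rewrite -raddfD /=; congr (_%:M); rewrite mulrCA -exprS -/e; ring.
(* The product is nonzero at exponent 0 and zero at [k.+1]; at the exponent [i] where it dies, the
   multiplier annihilates [a] as well as [w]. *)
right; have [i ri0 ria] : exists2 i, r * (s * (1 - e)) * a ^+ i != 0
    & r * (s * (1 - e)) * a ^+ i.+1 = 0.
  have rk : r * (s * (1 - e)) * a ^+ k.+1 = 0.
    by rewrite -/e -!mulrA mulrBl mul1r ek subrr !mulr0.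
  elim: (k) rk => [|k' IHk] rk; first by exists 0; rewrite ?expr0 ?mulr1.
  have [/IHk //|rk'] := eqVneq (r * (s * (1 - e)) * a ^+ k'.+1) 0.
  by exists k'.+1.
have rsE : r * (1 - e) * a ^+ i * s = r * (s * (1 - e)) * a ^+ i by ring.
exists (r * (1 - e) * a ^+ i); rewrite rsE // scale_row_mx.
rewrite [X in row_mx _ X](_ : _ = 0).
  by rewrite scale_scalar_mx -mulrA -exprSr ria raddf0 row_mx0.
by rewrite mulrC -scalerA rw scaler0.
Qed.

(** * Unimodular matrices and their reduction by column operations *)

Lemma unimodularP m N (A : 'M[R]_(m, N)) :
  reflect (exists B, A *m B = 1%:M) (unimodular A).
Proof. by apply: (iffP existsP) => -[B /eqP AB]; exists B => //; apply/eqP. Qed.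

Lemma unimodular_inj m N (A : 'M[R]_(m, N)) p :
  unimodular A -> injective (fun X : 'M_(p, m) => X *m A).
Proof.
by case/unimodularP=> B AB X Y /(congr1 (mulmx^~ B)); rewrite -!mulmxA AB !mulmx1.
Qed.

Lemma unimodular_mul m N p (A : 'M[R]_(m, N)) (B : 'M_(N, p)) :
  unimodular B -> unimodular (A *m B) = unimodular A.
Proof.
case/unimodularP=> C BC; apply/unimodularP/unimodularP => -[D].
  by rewrite -mulmxA => <-; exists (B *m D).
by move=> AD; exists (C *m D); rewrite mulmxA -(mulmxA A) BC mulmx1.
Qed.

Lemma unimodular1 m : unimodular (1%:M : 'M[R]_m).
Proof. by apply/unimodularP; exists 1%:M; rewrite mulmx1. Qed.

(** Counting replaces a rank argument: an injection gives [#|R| ^ m <= #|R| ^ N] with [#|R| > 1]. *)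
Lemma inj_mul_leq m N (A : 'M[R]_(m, N)) :
  (forall x : 'rV_m, x *m A = 0 -> x = 0) -> (m <= N)%N.
Proof.
move=> injA; have inj : injective (fun x : 'rV_m => x *m A).
  move=> x y /eqP; rewrite -subr_eq0 -mulmxBl => /eqP/injA/eqP.
  by rewrite subr_eq0 => /eqP.
have := leq_card _ inj; rewrite !card_mx !mul1n leq_exp2l //.
by apply/card_gt1P; exists 0, 1; rewrite // eq_sym oner_neq0.
Qed.

Lemma unimodular_inj0 m N (A : 'M[R]_(m, N)) p (x : 'M_(p, m)) :
  unimodular A -> x *m A = 0 -> x = 0.
Proof. by move=> uA xA; apply: (unimodular_inj uA); rewrite /= mul0mx. Qed.

Lemma unimodular_leq m N (A : 'M[R]_(m, N)) : unimodular A -> (m <= N)%N.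
Proof. by move=> uA; apply: (@inj_mul_leq _ _ A) => x; apply: unimodular_inj0. Qed.

(** By stable range one, adding a combination of the other entries ([g1]) turns the first entry into
    a unit [c]; [g2] scales it to 1 and clears the rest. *)
Lemma unimodular_row_reduce N (v : 'rV[R]_(1 + N)) : unimodular v ->
  exists g h : 'M[R]_(1 + N), [/\ g *m h = 1%:M, h *m g = 1%:M
    & v *m g = row_mx 1%:M 0].
Proof.
case/unimodularP=> B; rewrite -{1}(hsubmxK v) -{1}(vsubmxK B) mul_row_col.
set w := rsubmx v; set y := dsubmx B.
have [[a aE] [b ->] [d dE]] : [/\ exists a, lsubmx v = a%:M,
    exists b, usubmx B = b%:M & exists d, w *m y = d%:M].
  by split; eexists; apply: mx11_scalar.
rewrite aE dE -scalar_mxM -raddfD /= => /(congr1 (fun M : 'M_1 => M 0 0)).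
rewrite !mxE eqxx !mulr1n => bez.
have [z [u zu]] : exists z u, (a + d * z) * u = 1.
  by apply: (@stable_range_one a _ b 1); rewrite mulr1.
set c := a + _ in zu.
have wyz : w *m (z *: y) = (d * z)%:M.
  by rewrite -scalemxAr dE scale_scalar_mx mulrC.
pose g1 : 'M_(1 + N) := block_mx 1%:M 0 (z *: y) 1%:M.
pose h1 : 'M_(1 + N) := block_mx 1%:M 0 (- (z *: y)) 1%:M.
pose g2 : 'M_(1 + N) := block_mx u%:M (- (u *: w)) 0 1%:M.
pose h2 : 'M_(1 + N) := block_mx c%:M w 0 1%:M.
have gh1 : g1 *m h1 = 1%:M.
  rewrite mulmx_block !(mulmx1, mul1mx, mulmx0, mul0mx, addr0, add0r) subrr.
  by rewrite -scalar_mx_block.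
have gh2 : g2 *m h2 = 1%:M.
  rewrite mulmx_block !(mulmx1, mul1mx, mulmx0, mul0mx, addr0, add0r).
  by rewrite -scalar_mxM mul_scalar_mx subrr mulrC zu -scalar_mx_block.
exists (g1 *m g2), (h2 *m h1).
have gh : g1 *m g2 *m (h2 *m h1) = 1%:M.
  by rewrite mulmxA -(mulmxA g1) gh2 mulmx1.
split=> //; first exact: mulmx1C.
rewrite -(hsubmxK v) aE mulmxA -/w mul_row_block !(mulmx1, mulmx0, add0r) wyz.
rewrite -raddfD /= -/c mul_row_block !(mulmx1, mulmx0, addr0) -scalar_mxM zu.
by rewrite mulmxN -scalemxAr mul_scalar_mx scalerA (mulrC u) zu scale1r addNr.
Qed.

Lemma unimodular_block1 p a b (c : 'M[R]_(a, p)) (X : 'M_(a, b)) :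
  unimodular (block_mx 1%:M 0 c X) = unimodular X.
Proof.
apply/unimodularP/unimodularP => [[B]|[Y XY]].
  rewrite -(submxK B) mulmx_block scalar_mx_block !mul1mx !mul0mx !addr0.
  case/eq_block_mx=> _ -> _; rewrite mulmx0 add0r => XB.
  by exists (drsubmx B).
exists (block_mx 1%:M 0 (- (Y *m c)) Y); rewrite mulmx_block scalar_mx_block.
by rewrite !mul0mx mulmxN mulmxA XY !(mul1mx, mulmx1, mulmx0, addr0, add0r) subrr.
Qed.

Lemma unimodular_usubmx p a b (X : 'M[R]_(p + a, b)) :
  unimodular X -> unimodular (usubmx X).
Proof.
case/unimodularP=> B XB; apply/unimodularP; exists (lsubmx B).
move: XB; rewrite -{1}(vsubmxK X) -{1}(hsubmxK B) mul_col_row scalar_mx_block.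
by case/eq_block_mx.
Qed.

Lemma usubmx_mul_block p a b c (X : 'M[R]_(p + a, b)) (g : 'M_(b, p + c)) :
  usubmx X *m g = row_mx 1%:M 0 ->
  X *m g = block_mx 1%:M 0 (dlsubmx (X *m g)) (drsubmx (X *m g)).
Proof. by move=> Xg; rewrite -[LHS]vsubmxK -mul_usub_mx Xg block_mxEv hsubmxK. Qed.

(** The first row is reduced, then induction handles the lower right block. Letting [g] and [h] run
    between widths [b] and [a + r] avoids a cast. *)
Lemma unimodular_reduce a b (X : 'M[R]_(a, b)) : unimodular X ->
  exists r (g : 'M[R]_(b, a + r)) (h : 'M[R]_(a + r, b)),
  [/\ g *m h = 1%:M, h *m g = 1%:M & X *m g = row_mx 1%:M 0].
Proof.
elim: a => [|a IHa] in b X *.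
  move=> _; exists b, 1%:M, 1%:M.
  by split; rewrite ?mulmx1 // [LHS]flatmx0 [RHS]flatmx0.
case: b X => [|b] X uX; first by have := unimodular_leq uX.
rewrite -[a.+1]/(1 + a)%N -[b.+1]/(1 + b)%N in X uX *.
have [g1 [h1 [gh1 hg1 vg1]]] := unimodular_row_reduce (unimodular_usubmx uX).
have := usubmx_mul_block vg1; set c := dlsubmx _; set X' := drsubmx _ => Xg1.
have uX' : unimodular X'.
  rewrite -(unimodular_block1 c) -Xg1 unimodular_mul //.
  by apply/unimodularP; exists h1.
have [r [g2 [h2 [gh2 hg2 Xg2]]]] := IHa _ _ uX'.
pose g3 : 'M[R]_(1 + b, 1 + (a + r)) := block_mx 1%:M 0 0 g2.
pose h3 : 'M[R]_(1 + (a + r), 1 + b) := block_mx 1%:M 0 0 h2.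
(* The lower right block is now [[1, 0]], so its columns serve to clear the column [c] below the
   leading 1. *)
pose g4 : 'M[R]_(1 + (a + r)) := block_mx 1%:M 0 (- col_mx c 0) 1%:M.
pose h4 : 'M[R]_(1 + (a + r)) := block_mx 1%:M 0 (col_mx c 0) 1%:M.
have gh3 : g3 *m h3 = 1%:M.
  by rewrite mulmx_block gh2 !(mul1mx, mulmx1, mul0mx, mulmx0, addr0, add0r) -scalar_mx_block.
have hg3 : h3 *m g3 = 1%:M.
  by rewrite mulmx_block hg2 !(mul1mx, mulmx1, mul0mx, mulmx0, addr0, add0r) -scalar_mx_block.
have gh4 : g4 *m h4 = 1%:M.
  rewrite mulmx_block !(mul1mx, mulmx1, mul0mx, mulmx0, addr0, add0r) addNr.
  by rewrite -scalar_mx_block.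
have hg4 : h4 *m g4 = 1%:M by apply: mulmx1C.
have Xg : X *m (g1 *m g3 *m g4) = block_mx 1%:M 0 0 (row_mx 1%:M 0).
  rewrite !mulmxA Xg1 mulmx_block Xg2 !(mul1mx, mulmx1, mul0mx, mulmx0, addr0, add0r).
  rewrite mulmx_block !(mul1mx, mulmx1, mul0mx, mulmx0, addr0, add0r).
  by rewrite mulmxN mul_row_col mul1mx mulmx0 addr0 subrr.
exists r, (g1 *m g3 *m g4), (h4 *m h3 *m h1); split.
- by rewrite !mulmxA -(mulmxA _ g4) gh4 mulmx1 -(mulmxA _ g3) gh3 mulmx1.
- by rewrite !mulmxA -(mulmxA _ h1) hg1 mulmx1 -(mulmxA _ h3) hg3 mulmx1.
apply: etrans Xg _; rewrite -[0 in X in block_mx _ X _ _]row_mx0 block_mxEh.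
rewrite -block_mxEv block_mxEh row_mxA castmx_id -block_mxEh -scalar_mx_block.
by rewrite col_mx0.
Qed.

(* A special case of McCoy's theorem. *)
Lemma free_unimodular a b (B : 'M[R]_(a, b)) :
  (forall x : 'rV_a, x *m B = 0 -> x = 0) -> unimodular B.
Proof.
elim: a => [|a IHa] in b B *.
  by move=> _; apply/unimodularP; exists 0; rewrite [LHS]flatmx0 [RHS]flatmx0.
case: b B => [|b] B freeB; first by have := inj_mul_leq freeB.
rewrite -[a.+1]/(1 + a)%N -[b.+1]/(1 + b)%N in B freeB *.
have uv : unimodular (usubmx B).
  case: (ideal_or_annihilator (usubmx B) 1) => [/unimodularP //|[c]].
  rewrite mulr1 => c0 cB; case/negP: c0; apply/eqP.
  have /freeB/eqP : row_mx c%:M 0 *m B = 0.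
    by rewrite -(vsubmxK B) mul_row_col mul0mx addr0 mul_scalar_mx.
  rewrite row_mx_eq0 => /andP[/eqP/(congr1 (fun M : 'M_1 => M 0 0)) + _].
  by rewrite !mxE eqxx.
have [g [h [gh hg vg]]] := unimodular_row_reduce uv.
have := usubmx_mul_block vg; set c := dlsubmx _; set X := drsubmx _ => Bg.
have ug : unimodular g by apply/unimodularP; exists h.
rewrite -(unimodular_mul B ug) Bg unimodular_block1; apply: IHa => x xX.
(* A relation [x] among the rows of [X] lifts to the rows of [B]: the coefficient of the first row
   is chosen to cancel the column [c]. *)
have /freeB/eqP : row_mx (- (x *m c)) x *m B = 0.
  apply: (unimodular_inj0 ug); rewrite -mulmxA Bg mul_row_block mulmx1 mulmx0.
  by rewrite xX addNr addr0 row_mx0.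
by rewrite row_mx_eq0 => /andP[_ /eqP].
Qed.

(** * Row spans and block triangular bases of (m,t)-subspaces *)

Lemma rowspanP m N (A : 'M[R]_(m, N)) x :
  reflect (exists y, x = y *m A) (x \in rowspan A).
Proof.
by apply: (iffP imsetP) => [[y _ ->]|[y ->]]; exists y.
Qed.

Lemma rowspan_subP m p N (A : 'M[R]_(m, N)) (B : 'M_(p, N)) :
  reflect (exists X, B = X *m A) (rowspan B \subset rowspan A).
Proof.
apply: (iffP subsetP) => [sBA|[X ->] _ /rowspanP[y ->]]; last first.
  by apply/rowspanP; exists (y *m X); rewrite mulmxA.
have /fin_all_exists[f fP] i : exists y, row i B = y *m A.
  by apply/rowspanP/sBA/rowspanP; exists (delta_mx 0 i); rewrite rowE.
exists (\matrix_i f i); apply/row_matrixP => i.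
by rewrite row_mul rowK.
Qed.

Lemma subspaceP m N (V : {set 'rV[R]_N}) :
  reflect (exists2 A : 'M_(m, N), unimodular A & V = rowspan A) (subspace m V).
Proof.
apply: (iffP existsP) => [[A /andP[uA /andP[_ /eqP ->]]]|[A uA ->]]; exists A => //.
rewrite uA /rows_basis eqxx andbT; apply/forallP => x; apply/implyP => /eqP xA.
by apply/eqP; apply: (unimodular_inj0 uA).
Qed.

Lemma EspaceE n k (x : 'rV[R]_(n + k)) : (x \in Espace R n k) = (lsubmx x == 0).
Proof.
have EE : \matrix_(i < k) delta_mx 0 (rshift n i) = row_mx 0 1%:M :> 'M[R]_(k, n + k).
  apply/row_matrixP => i; rewrite rowK row_row_mx row0 row1.
  apply/rowP => j; case: (split_ordP j) => j' ->.
    by rewrite row_mxEl !mxE eq_lrshift andbF.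
  by rewrite row_mxEr !mxE eq_rshift.
rewrite /Espace EE; apply/rowspanP/eqP => [[y ->]|x0].
  by rewrite mul_mx_row mulmx0 row_mxKl.
by exists (rsubmx x); rewrite mul_mx_row mulmx0 mulmx1 -x0 hsubmxK.
Qed.

(* Bases [[B, C], [0, D]] whose last [t] rows span the intersection with [E]. *)
Definition adapted r t n k (A : 'M[R]_(r + t, n + k)) : bool :=
  [&& dlsubmx A == 0, unimodular (ulsubmx A) & unimodular (drsubmx A)].

Lemma adapted_unimodular r t n k (A : 'M[R]_(r + t, n + k)) :
  adapted A -> unimodular A.
Proof.
case/and3P=> /eqP A0 /unimodularP[B AB] /unimodularP[D AD].
apply/unimodularP; exists (block_mx B (- (B *m ursubmx A *m D)) 0 D).
rewrite -{1}(submxK A) A0 mulmx_block AB AD !(mul0mx, mulmx0, add0r, addr0).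
by rewrite mulmxN !mulmxA AB mul1mx addNr -scalar_mx_block.
Qed.

(** Since [ulsubmx A] cancels on the right, the lower left block of the product vanishes only with
    that of [X]. Coordinates in an adapted basis thus keep the block shape. *)
Lemma adapted_mul r t p q n k (X : 'M[R]_(r + t, p + q)) (A : 'M[R]_(p + q, n + k)) :
  adapted A -> adapted (X *m A) = adapted X.
Proof.
case/and3P=> /eqP A0 uB uD; rewrite /adapted.
have -> : X *m A = block_mx (ulsubmx X *m ulsubmx A)
    (ulsubmx X *m ursubmx A + ursubmx X *m drsubmx A)
    (dlsubmx X *m ulsubmx A) (dlsubmx X *m ursubmx A + drsubmx X *m drsubmx A).
  by rewrite -{1}(submxK X) -{1}(submxK A) mulmx_block A0 !mulmx0 !addr0.
rewrite block_mxKul block_mxKdl block_mxKdr (unimodular_mul _ uB).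
have -> : (dlsubmx X *m ulsubmx A == 0) = (dlsubmx X == 0).
  by apply/eqP/eqP => [|->]; [exact: unimodular_inj0 | rewrite mul0mx].
by case: eqP => //= ->; rewrite mul0mx add0r (unimodular_mul _ uD).
Qed.

(** A basis [F] of the intersection has unimodular coordinates [X] in a basis of [P], so
    [unimodular_reduce] completes it to a basis of [P]; listing [F] last yields the zero block. *)
Lemma mt_subspaceP n k m t (P : {set 'rV[R]_(n + k)}) :
  reflect (exists r (A : 'M_(r + t, n + k)),
             [/\ m = (r + t)%N, adapted A & P = rowspan A])
          (mt_subspace m t P).
Proof.
apply: (iffP andP) => [[/subspaceP[A uA PA] /subspaceP[F uF PEF]]|[r [A [-> aA ->]]]].
  have [X FX] : exists X, F = X *m A.
    by apply/rowspan_subP; rewrite -PA -PEF subsetIl.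
  have F0 : lsubmx F = 0.
    apply/row_matrixP => i; rewrite row0.
    have -> : row i (lsubmx F) = lsubmx (row i F) by apply/rowP => j; rewrite !mxE.
    apply/eqP; rewrite -EspaceE.
    have : row i F \in P :&: Espace R n k.
      by rewrite PEF; apply/rowspanP; exists (delta_mx 0 i); rewrite rowE.
    by rewrite inE => /andP[].
  have uX : unimodular X by rewrite -(unimodular_mul X uA) -FX.
  have [r [g [h [gh hg Xg]]]] := unimodular_reduce uX.
  have XE : X = usubmx h.
    by rewrite -[X]mulmx1 -gh mulmxA Xg -{1}(vsubmxK h) mul_row_col mul1mx mul0mx addr0.
  (* [G] is [h] with its top rows, which form [X], moved to the bottom, so that [G *m A] ends with
     [F]; [K] is the inverse, with columns permuted to match. *)
  pose G := col_mx (dsubmx h) X; pose K := row_mx (rsubmx g) (lsubmx g).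
  have KG : K *m G = 1%:M.
    by rewrite mul_row_col XE addrC -mul_row_col hsubmxK vsubmxK.
  have GK : G *m K = 1%:M.
    move: hg; rewrite -{1}(vsubmxK h) -{1}(hsubmxK g) mul_col_row scalar_mx_block.
    rewrite -XE => /eq_block_mx[h1 h2 h3 h4].
    by rewrite mul_col_row h1 h2 h3 h4 -scalar_mx_block.
  have uG : unimodular G by apply/unimodularP; exists K.
  have uK : unimodular K by apply/unimodularP; exists G.
  have PGA : P = rowspan (G *m A).
    apply/eqP; rewrite PA eqEsubset; apply/andP; split; apply/rowspan_subP.
      by exists K; rewrite mulmxA KG mul1mx.
    by exists G.
  have uGA : unimodular (G *m A) by rewrite unimodular_mul.
  have dGA : dsubmx (G *m A) = F by rewrite -mul_dsub_mx col_mxKd -FX.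
  exists r, (G *m A); split=> //.
    by apply/eqP; rewrite eqn_leq (unimodular_leq uG) (unimodular_leq uK).
  apply/and3P; split.
  - by rewrite /dlsubmx dGA F0.
  (* A relation among the rows of the upper left block yields a vector of [P] in [E], hence a
     combination of the last [t] rows; independence of all rows makes it trivial. *)
  - apply: free_unimodular => x xB.
    have : row_mx x 0 *m (G *m A) \in P :&: Espace R n k.
      rewrite inE EspaceE PGA; apply/andP; split.
        by apply/rowspanP; exists (row_mx x 0).
      rewrite -(vsubmxK (G *m A)) mul_row_col mul0mx addr0 -mulmx_lsub.
      by rewrite -/(ulsubmx _) xB.
    rewrite PEF => /rowspanP[y]; rewrite -dGA => yE.
    have /(unimodular_inj uGA)/eq_row_mx[] // :
      row_mx x 0 *m (G *m A) = row_mx 0 y *m (G *m A).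
    by rewrite yE -{2}(vsubmxK (G *m A)) mul_row_col mul0mx add0r.
  rewrite /drsubmx dGA; have /unimodularP[Y FY] := uF.
  apply/unimodularP; exists (dsubmx Y).
  by rewrite -FY -{2}(hsubmxK F) -{2}(vsubmxK Y) mul_row_col F0 mul0mx add0r.
have uA := adapted_unimodular aA; have /and3P[/eqP A0 uB uD] := aA.
split; apply/subspaceP; first by exists A.
exists (dsubmx A).
  have/unimodularP[D AD] := uD; apply/unimodularP; exists (col_mx 0 D).
  by rewrite -(hsubmxK (dsubmx A)) mul_row_col mulmx0 add0r.
apply/setP => x; rewrite inE EspaceE; apply/andP/rowspanP => [[/rowspanP[y ->]]|[y ->]].
  rewrite -{1}(hsubmxK y) -{1}(vsubmxK A) mul_row_col raddfD /= -!mulmx_lsub.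
  rewrite -/(dlsubmx A) A0 mulmx0 addr0 => /eqP/(unimodular_inj0 uB) y0.
  by exists (rsubmx y); rewrite -{1}(hsubmxK y) y0 -{1}(vsubmxK A) mul_row_col mul0mx add0r.
split; last by rewrite -mulmx_lsub -/(dlsubmx A) A0 mulmx0.
apply/rowspanP; exists (row_mx 0 y).
by rewrite -{2}(vsubmxK A) mul_row_col mul0mx add0r.
Qed.

End FiniteRing.

(** * Counting subspaces through unimodular matrices *)

Lemma card_uniform_fibers (T S : finType) (f : T -> S) (A : {set T}) c :
  (forall x, x \in A -> #|[set y in A | f y == f x]| = c) ->
  #|A| = (#|f @: A| * c)%N.
Proof.
move=> fib; rewrite -sum1_card (partition_big_imset f) -sum_nat_const.
apply: eq_bigr => _ /imsetP[x xA ->]; rewrite -(fib x xA) -sum1_card.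
by apply: eq_bigl => y; rewrite inE.
Qed.

Section Counting.
Variable R : finComNzRingType.

Definition num_unimodular a b : nat := #|[set A : 'M[R]_(a, b) | unimodular A]|.

Definition num_adapted r t n k : nat :=
  #|[set A : 'M[R]_(r + t, n + k) | adapted A]|.

Lemma card_ring_gt1 : (1 < #|R|)%N.
Proof. by apply/card_gt1P; exists 0, 1; rewrite // eq_sym oner_neq0. Qed.

Lemma num_adaptedE r t n k :
  num_adapted r t n k =
  (num_unimodular r n * num_unimodular t k * #|R| ^ (r * k))%N.
Proof.
pose f (x : 'M[R]_(r, n) * 'M[R]_(t, k) * 'M[R]_(r, k)) : 'M[R]_(r + t, n + k) :=
  block_mx x.1.1 x.2 0 x.1.2.
have injf : injective f.
  by move=> [[B D] C] [[B' D'] C'] /eq_block_mx[/= -> -> _ ->].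
rewrite /num_unimodular -card_mx -cardsT -!cardsX -(card_imset _ injf).
apply: eq_card => A; rewrite inE; apply/idP/imsetP => [/and3P[/eqP A0 uB uD]|].
  exists (ulsubmx A, drsubmx A, ursubmx A); first by rewrite !inE uB uD.
  by rewrite /f /= -A0 submxK.
case=> -[[B D] C]; rewrite !inE andbT /= => /andP[uB uD] ->.
by rewrite /adapted /f /= block_mxKul block_mxKdl block_mxKdr eqxx uB.
Qed.

Lemma num_unimodular_sq_gt0 a : (0 < num_unimodular a a)%N.
Proof. by apply/card_gt0P; exists 1%:M; rewrite inE unimodular1. Qed.

Section InSubspace.
Variables (n k p q r t : nat) (A0 : 'M[R]_(p + q, n + k)).
Hypothesis aA0 : adapted A0.

Lemma mt_subspaces_inE :
  mt_subspaces_in (r + t) t (rowspan A0) =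
  (fun X : 'M[R]_(r + t, p + q) => rowspan (X *m A0)) @: [set X | adapted X].
Proof.
apply/setP => Q; rewrite inE; apply/andP/imsetP => [[/mt_subspaceP]|[X]].
  case=> r' [A [/eqP]]; rewrite eqn_add2r => /eqP er; case: _ / er A => A aA ->.
  case/rowspan_subP=> X AX; exists X; last by rewrite AX.
  by rewrite inE -(adapted_mul X aA0) -AX.
rewrite inE => aX ->; split; last by apply/rowspan_subP; exists X.
by apply/mt_subspaceP; exists r, (X *m A0); rewrite adapted_mul.
Qed.

(** Adapted [X] and [Y] give the same subspace exactly when [Y = G *m X] with [G] square and
    adapted; [G] is unique because [X] is right invertible. *)
Lemma card_mt_subspaces_in :
  num_adapted r t p q =
  (#|mt_subspaces_in (r + t) t (rowspan A0)| * num_adapted r t r t)%N.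
Proof.
rewrite mt_subspaces_inE; apply: card_uniform_fibers => X; rewrite inE => aX.
have uX := adapted_unimodular aX; have uA0 := adapted_unimodular aA0.
rewrite /num_adapted -[RHS](card_imset _ (@unimodular_inj _ _ _ _ (r + t) uX)).
apply: eq_card => Y; rewrite !inE; apply/andP/imsetP => [[aY /eqP eqYX]|[G]].
  have /rowspan_subP[G] : rowspan (Y *m A0) \subset rowspan (X *m A0).
    by rewrite eqYX.
  rewrite mulmxA => /(unimodular_inj uA0) YG; exists G => //.
  by rewrite inE -(adapted_mul G aX) -YG.
rewrite inE => aG ->; rewrite adapted_mul //; split=> //.
have /unimodularP[H GH] := adapted_unimodular aG.
rewrite eqEsubset; apply/andP; split; apply/rowspan_subP.
  by exists G; rewrite mulmxA.
by exists H; rewrite !mulmxA (mulmx1C GH) mul1mx.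
Qed.

End InSubspace.

Lemma num_unimodular0 b : num_unimodular 0 b = 1%N.
Proof.
rewrite /num_unimodular (_ : [set _ | _] = setT) ?cardsT ?card_mx //.
apply/setP => A; rewrite !inE; apply/unimodularP; exists 0.
by rewrite [LHS]flatmx0 [RHS]flatmx0.
Qed.

(** For [n = 0] the space [E] is all of [R^b], so [a]-subspaces are (a,a)-subspaces of the full
    space and the fibre count with [r = 0] applies. *)
Lemma num_unimodular_subspaces a b :
  num_unimodular a b = (#|subspaces R a b| * num_unimodular a a)%N.
Proof.
have a1 : adapted (1%:M : 'M[R]_(0 + b, 0 + b)).
  apply/and3P; rewrite scalar_mx_block block_mxKdl block_mxKul block_mxKdr.
  by rewrite !unimodular1 eqxx.
have := card_mt_subspaces_in 0 a a1; rewrite !num_adaptedE !mul0n !expn0 !muln1.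
rewrite num_unimodular0 !mul1n => ->; congr (#|pred_of_set _| * _)%N; apply/setP => Q.
have ET : Espace R 0 b = setT.
  by apply/setP => x; rewrite EspaceE [lsubmx x]thinmx0 eqxx inE.
rewrite !inE /mt_subspace ET setIT andbb andbC -[RHS]andTb; congr (_ && _).
by apply/subsetP => x _; apply/rowspanP; exists x; rewrite mulmx1.
Qed.

Lemma num_unimodular_rec a b :
  num_unimodular a.+1 b.+1 =
  (num_unimodular 1 b.+1 * (#|R| ^ a * num_unimodular a b))%N.
Proof.
rewrite {1}/num_unimodular -[a.+1]/(1 + a)%N -[b.+1]/(1 + b)%N.
rewrite -sum1dep_card (partition_big usubmx (@unimodular R 1 (1 + b))) /=; last first.
  exact: unimodular_usubmx.
rewrite -sum_nat_const; apply: congr_big => // [v|v uv]; first by rewrite inE.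
have [g [h [gh hg vg]]] := unimodular_row_reduce uv.
have uh : unimodular h by apply/unimodularP; exists g.
pose f (x : 'cV[R]_a * 'M[R]_(a, b)) : 'M[R]_(1 + a, 1 + b) :=
  block_mx 1%:M 0 x.1 x.2 *m h.
have injf : injective f.
  by move=> [c X] [c' X'] /(unimodular_inj uh)/eq_block_mx[_ _ /= -> ->].
rewrite -(muln1 a) -card_mx muln1 -cardsT -cardsX -(card_imset _ injf) sum1dep_card.
apply: eq_card => A; rewrite inE; apply/andP/imsetP => [[uA /eqP Av]|].
  have Ag := usubmx_mul_block (etrans (congr1 (mulmx^~ g) Av) vg).
  exists (dlsubmx (A *m g), drsubmx (A *m g)).
    rewrite !inE -(unimodular_block1 (dlsubmx (A *m g))) -Ag unimodular_mul //.
    by apply/unimodularP; exists h.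
  by rewrite /f /= -Ag -mulmxA gh mulmx1.
case=> -[c X]; rewrite !inE /= => uX ->; rewrite unimodular_mul ?unimodular_block1 //.
by split=> //; rewrite -mul_usub_mx block_mxEv col_mxKu -vg -mulmxA gh mulmx1.
Qed.

(** The power of [#|R|] in [num_unimodular_rec] depends only on [a], so it cancels in the
    quotient. *)
Lemma num_unimodular_ratio a b :
  (num_unimodular a b)%:R / (num_unimodular a a)%:R =
  \prod_(i < a) ((num_unimodular 1 (b - i))%:R / (num_unimodular 1 (a - i))%:R)
  :> rat.
Proof.
elim: a => [|a IHa] in b *.
  by rewrite big_ord0 !num_unimodular0 divr1.
rewrite big_ord_recl !subn0.
(* At [b = 0] both sides vanish, the right one through its first factor; so the truncation of
   [b - i] does no harm when [b < a]. *)
case: b => [|b].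
  have U0 c : num_unimodular c.+1 0 = 0%N.
    by apply: eq_card0 => A; rewrite inE; case: (boolP (unimodular A)) => // /unimodular_leq.
  by rewrite !U0 !mul0r.
rewrite (num_unimodular_rec a b) (num_unimodular_rec a a) !natrM.
under eq_bigr do rewrite /= !subSS.
rewrite -IHa.
have R0 : (#|R| ^ a)%:R != 0 :> rat.
  by rewrite pnatr_eq0 -lt0n expn_gt0 (ltnW card_ring_gt1).
have := num_unimodular_sq_gt0 a; rewrite lt0n -(@pnatr_eq0 rat) => U0.
have := num_unimodular_sq_gt0 a.+1; rewrite (num_unimodular_rec a a) lt0n.
rewrite -(@pnatr_eq0 rat) natrM mulf_eq0 negb_or => /andP[u0 _].
by field; rewrite R0 U0 u0.
Qed.

End Counting.

(** * Local rings: units and vectors outside the maximal ideal *)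

Section LocalRing.
Variables (A : finComNzRingType) (M : {set A}).
Hypothesis locM : local_ring_with M.

Lemma local_ideal : idealr_closed M.
Proof. by case: locM => -[]. Qed.

(** If [x] had no inverse, its multiples would form a proper ideal; by finiteness this lies in a
    maximal one, which must be [M]. *)
Lemma local_unit (x : A) : x \notin M -> exists y, x * y = 1.
Proof.
move=> xM; apply/exists_eqP; apply: contraNT xM; rewrite negb_exists => /forallP xV.
pose idealb (J : {set A}) := [&& 0 \in J, 1 \notin J
  & [forall a, forall u in J, forall v in J, a * u + v \in J]].
have idealP (J : {set A}) : reflect (idealr_closed J) (idealb J).
  apply: (iffP and3P) => -[J0 J1 JD]; split=> //.
    by move=> a u v uJ vJ; have /forallP/(_ a)/forall_inP/(_ u uJ)/forall_inP/(_ v vJ) := JD.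
  by apply/forallP => a; apply/forall_inP => u uJ; apply/forall_inP => v vJ; apply: JD.
have [|J] := @maxset_exists _ idealb [set x * y | y : A].
  apply/idealP; split.
  - by apply/imsetP; exists 0; rewrite ?mulr0.
  - by apply/imsetP => -[y _ /esym/eqP]; apply/negP.
  - move=> a _ _ /imsetP[u _ ->] /imsetP[v _ ->]; apply/imsetP.
    by exists (a * u + v); rewrite // mulrDr mulrCA.
case/maxsetP=> /idealP idJ maxJ /subsetP/(_ x).
have [_ /(_ J) <-] := locM; first by apply; apply/imsetP; exists 1; rewrite ?mulr1.
by split=> // K /idealP idK; apply: maxJ.
Qed.

Lemma local_max_card : (#|M| < #|A|)%N.
Proof.
have [_ M1 _] := local_ideal; rewrite -cardsT; apply: proper_card.
by apply/properP; split; [apply/subsetP | exists 1].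
Qed.

Lemma card_local_unimodular_rows N :
  #|[set w : 'rV[A]_N | [exists i, w 0 i \notin M]]| =
  (#|A| ^ N - #|M| ^ N)%N.
Proof.
set S := [set w | _]; have cS : #|~: S| = (#|M| ^ N)%N.
  pose f (h : {ffun 'I_N -> A}) := \row_i h i.
  have injf : injective f.
    by move=> g h /rowP eq_gh; apply/ffunP => i; have := eq_gh i; rewrite !mxE.
  rewrite -[N in RHS]card_ord -card_ffun_on -(card_imset _ injf).
  apply: eq_card => w; rewrite !inE negb_exists.
  apply/forallP/imsetP => [wM|[h /ffun_onP hM ->] i]; last first.
    by rewrite negbK mxE.
  exists [ffun i => w 0 i]; last by apply/rowP => i; rewrite !mxE ffunE.
  by apply/ffun_onP => i; rewrite ffunE -[_ \in _]negbK.
by have := cardsC S; rewrite cS card_mx mul1n => <-; rewrite addnK.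
Qed.

End LocalRing.

(** * Decomposition into local factors and the product formula *)

Section Decomposition.
Variables (R : finComNzRingType) (l : nat) (Rj : 'I_l -> finComNzRingType).
Variables (Mj : forall j : 'I_l, {set Rj j}).
Variables (proj : forall j : 'I_l, {rmorphism R -> Rj j}).
Hypothesis hR : is_direct_product proj.
Hypothesis hloc : forall j : 'I_l, local_ring_with (Mj j).

Lemma proj_inj (x y : R) : (forall j, proj j x = proj j y) -> x = y.
Proof.
move=> eq_xy; have [z [_ uz]] := hR (fun j => proj j y).
exact: etrans (esym (uz x eq_xy)) (uz y (fun j => erefl)).
Qed.

Lemma proj_ex (y : forall j, Rj j) : exists x, forall j, proj j x = y j.
Proof. by have [x []] := hR y; exists x. Qed.

(** If all entries project into [Mj j], so does every combination of them, and 1 cannot be one.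
    Conversely, the direct product glues inverses of one entry per factor into global
    coefficients. *)
Lemma unimodular_row_local N (v : 'rV[R]_N) :
  unimodular v = [forall j, [exists i, proj j (v 0 i) \notin Mj j]].
Proof.
apply/unimodularP/forallP => [[B vB] j|].
  apply: contraT; rewrite negb_exists => /forallP vM; have [M0 M1 MD] := local_ideal (hloc j).
  case/negP: M1; have /(congr1 (fun X : 'M_1 => proj j (X 0 0))) := vB.
  rewrite !mxE eqxx rmorph1 rmorph_sum => <-; elim/big_rec: _ => // i x _ xM.
  by rewrite rmorphM mulrC; apply: MD => //; rewrite -[_ \in _]negbK.
move=> vU.
have /fin_all_exists[f fP] j : exists p : 'I_N * Rj j, proj j (v 0 p.1) * p.2 = 1.
  by have /existsP[i /(local_unit (hloc j))[y vy]] := vU j; exists (i, y).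
have /fin_all_exists[b bP] i :
    exists x, forall j, proj j x = if i == (f j).1 then (f j).2 else 0.
  exact: proj_ex.
exists (\col_i b i); rewrite [LHS]mx11_scalar; congr (_%:M); apply: proj_inj => j.
rewrite mxE rmorph_sum rmorph1 (bigD1 (f j).1) //= mxE rmorphM bP eqxx fP.
rewrite big1 ?addr0 // => i /negPf ni.
by rewrite mxE rmorphM bP ni mulr0.
Qed.

(** Rows over [R] are families of rows over the [Rj j], and unimodularity is tested factor by
    factor, so the counts multiply. *)
Lemma num_unimodular_row N :
  (num_unimodular R 1 N)%:R =
  \prod_(j < l) (#|Rj j|%:R ^+ N - #|Mj j|%:R ^+ N) :> rat.
Proof.
pose S j := [set w : 'rV[Rj j]_N | [exists i, w 0 i \notin Mj j]].
pose f (v : 'rV[R]_N) : {dffun forall j : 'I_l, 'rV[Rj j]_N} :=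
  [ffun j => map_mx (proj j) v].
have injf : injective f.
  move=> v w eq_vw; apply/rowP => i; apply: proj_inj => j.
  by have := congr1 (fun h : {dffun forall j : 'I_l, 'rV[Rj j]_N} => h j 0 i) eq_vw;
     rewrite /= !ffunE !mxE.
have -> : num_unimodular R 1 N = #|setXn S|.
  rewrite /num_unimodular -(card_imset _ injf); apply: eq_card => w; rewrite in_setXn.
  apply/imsetP/forallP => [[v + ->] j|wS].
    rewrite inE unimodular_row_local => /forallP/(_ j)/existsP[i vi].
    by rewrite inE ffunE; apply/existsP; exists i; rewrite mxE.
  have /fin_all_exists[v vP] i : exists x, forall j, proj j x = w j 0 i.
    exact: proj_ex.
  exists (\row_i v i); last first.
    by apply/ffunP => j; rewrite ffunE; apply/rowP => i; rewrite !mxE vP.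
  rewrite inE unimodular_row_local; apply/forallP => j.
  by have := wS j; rewrite inE => /existsP[i wi]; apply/existsP; exists i; rewrite mxE vP.
rewrite cardsXn natr_prod; apply: eq_bigr => j _.
rewrite card_local_unimodular_rows natrB ?natrX //.
have [->|N0] := posnP N; first by rewrite !expn0.
by rewrite leq_exp2r // ltnW // local_max_card.
Qed.

Lemma NR_ratio a b :
  NR Mj a b = (num_unimodular R a b)%:R / (num_unimodular R a a)%:R.
Proof.
rewrite num_unimodular_ratio /NR exchange_big /=; apply: eq_bigr => i _.
by rewrite !num_unimodular_row prodf_div.
Qed.

Lemma card_subspaces a b : #|subspaces R a b|%:R = NR Mj a b.
Proof.
rewrite NR_ratio num_unimodular_subspaces natrM mulfK //.
by rewrite pnatr_eq0 -lt0n num_unimodular_sq_gt0.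
Qed.

Lemma card_mt_subspaces_inE n k p q r t (A0 : 'M[R]_(p + q, n + k)) :
  adapted A0 -> (t <= q)%N ->
  #|mt_subspaces_in (r + t) t (rowspan A0)|%:R =
  #|R|%:R ^+ (r * (q - t)) * NR Mj r p * NR Mj t q.
Proof.
move=> aA0 le_tq; rewrite !NR_ratio.
have /(congr1 (fun x => x%:R : rat)) := card_mt_subspaces_in r t aA0.
rewrite !num_adaptedE !natrM !natrX.
have := num_unimodular_sq_gt0 R r; rewrite lt0n -(@pnatr_eq0 rat) => Ur.
have := num_unimodular_sq_gt0 R t; rewrite lt0n -(@pnatr_eq0 rat) => Ut.
have R0 : #|R|%:R != 0 :> rat by rewrite pnatr_eq0 -lt0n (ltnW (card_ring_gt1 R)).
(* The free upper right blocks contribute [r * q] to the exponent of [#|R|] in the total and [r * t]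
   in each fibre. *)
have -> : (r * q = r * (q - t) + r * t)%N by rewrite -mulnDr subnK.
rewrite exprD mulrA.
rewrite [in RHS]mulrA => /(mulIf (expf_neq0 _ R0)) eqU.
apply: (mulIf Ur); apply: (mulIf Ut); rewrite -mulrA -eqU.
by field; rewrite Ur Ut.
Qed.

End Decomposition.

(** * Non-emptiness and the final count *)

(** A unimodular block has at most as many rows as columns, which gives both inequalities;
    conversely two partial identities [pid_mx] on the diagonal form an adapted matrix. *)
Lemma mt_subspaces_in_neq0 (R : finComNzRingType) n k p q r t
    (A0 : 'M[R]_(p + q, n + k)) : adapted A0 ->
  (mt_subspaces_in (r + t) t (rowspan A0) != set0) = (r <= p)%N && (t <= q)%N.
Proof.
move=> aA0; rewrite mt_subspaces_inE //; apply/set0Pn/andP => [[_ /imsetP[X +  _]]|].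
  by rewrite inE => /and3P[_ /unimodular_leq -> /unimodular_leq ->].
case=> le_rp le_tq; eexists; apply: imset_f; rewrite inE.
have upid a b : (a <= b)%N -> unimodular (pid_mx a : 'M[R]_(a, b)).
  move=> le_ab; apply/unimodularP; exists (pid_mx a).
  by rewrite pid_mx_id // pid_mx_1.
instantiate (1 := block_mx (pid_mx r) 0 0 (pid_mx t)).
by rewrite /adapted block_mxKul block_mxKdl block_mxKdr eqxx !upid.
Qed.

Theorem theorem5p2
  (R : finComNzRingType) (l : nat) (Rj : 'I_l -> finComNzRingType)
  (Mj : forall j : 'I_l, {set Rj j})
  (proj : forall j : 'I_l, {rmorphism R -> Rj j})
  (hR : is_direct_product proj)
  (hloc : forall j : 'I_l, local_ring_with (Mj j))
  (n k m t m1 t1 : nat)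
  (P : {set 'rV[R]_(n + k)}) (hP : mt_subspace m t P) :
  [/\ (mt_subspaces_in m1 t1 P <> set0) <->
        [/\ (0 <= t1)%N, (t1 <= t)%N & (t <= k)%N] /\
        [/\ 0 <= m1%:Z - t1%:Z, m1%:Z - t1%:Z <= m%:Z - t%:Z
          & m%:Z - t%:Z <= n%:Z],
      mt_subspaces_in m1 t1 P <> set0 ->
        (forall P' : {set 'rV[R]_(n + k)}, mt_subspace m t P' ->
           #|mt_subspaces_in m1 t1 P'| = #|mt_subspaces_in m1 t1 P|) /\
        (#|mt_subspaces_in m1 t1 P|%:R : rat) =
          #|R|%:R ^+ ((m1 - t1) * (t - t1)) *
          NR Mj (m1 - t1) (m - t) * NR Mj t1 t
    & forall a b : nat, (#|subspaces R a b|%:R : rat) = NR Mj a b].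
Proof.
have m1E (Q : {set 'rV[R]_(n + k)}) :
    mt_subspaces_in m1 t1 Q <> set0 -> m1 = (m1 - t1 + t1)%N.
  move/eqP/set0Pn=> [V]; rewrite inE => /andP[/mt_subspaceP[r [_ [-> _ _]]] _].
  by rewrite addnK.
have [p [A [mE aA PA]]] := mt_subspaceP _ _ _ hP.
have nonempty : (mt_subspaces_in m1 t1 P <> set0) <->
    [/\ (t1 <= m1)%N, (m1 - t1 <= p)%N & (t1 <= t)%N].
  rewrite PA; split=> [ne|[le1 le2 le3]].
    have := m1E _ ne; move: ne => /[swap] e /eqP.
    rewrite {1}e mt_subspaces_in_neq0 // => /andP[le2 le3].
    by split=> //; rewrite e leq_addl.
  by apply/eqP; rewrite -(subnK le1) mt_subspaces_in_neq0 // le2.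
split; last by move=> a b; apply: card_subspaces hR hloc _ _.
  have /and3P[_ /unimodular_leq le_pn /unimodular_leq le_tk] := aA.
  by rewrite nonempty; split=> [[le1 le2 le3]|[[_ le1 le2] [le3 le4 le5]]]; repeat split; lia.
move=> ne; have [le1 le2 le3] := (nonempty.1 ne).
(* The value is the same expression for every [Q], so this one count gives both the independence of
   [P] and the formula. *)
have main (Q : {set 'rV[R]_(n + k)}) : mt_subspace m t Q ->
    (#|mt_subspaces_in m1 t1 Q|%:R : rat) =
    #|R|%:R ^+ ((m1 - t1) * (t - t1)) * NR Mj (m1 - t1) (m - t) * NR Mj t1 t.
  case/mt_subspaceP=> p' [A' [mE' aA' ->]].
  have -> : (m - t = p')%N by rewrite mE' addnK.
  by rewrite -{1}(subnK le1) (card_mt_subspaces_inE hR hloc).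
split=> [Q mtQ|]; last exact: main.
by apply/eqP; rewrite -(eqr_nat rat) !main.
Qed.
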